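(* Let $a_1+a_2=1$ with $|a_2|<1$, and let $X$ be the AR(2)-process with these coefficients. Assume $\mathbb{E}[Y_1]=0$ and $\mathbb{E}[Y_1^2]\in(0,\infty)$. (1) If $a_2>0$, then $p_N(x)\precsim N^{-1/2}$ for all $x\ge0$. (2) If $a_2<0$, then $p_N(x)\succsim N^{-1/2}$ for all $x\ge0$.
   Context: Let $(Y_n)_{n\ge1}$ be i.i.d. nondegenerate real random variables. The AR(2)-process is $X_n=a_1X_{n-1}+a_2X_{n-2}+Y_n$ for $n\ge1$ with $X_n=0$ for $n\le0$; $p_N(x):=\mathbb{P}(\sup_{n=1,\dots,N}X_n\le x)$. $f\precsim g$ means $\limsup_{N\to\infty} f(N)/g(N)<\infty$; $f\succsim g$ means $g\precsim f$. *)

(* Defs.v *)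
From HB Require Import structures.
From mathcomp Require Import all_boot all_order all_algebra.
From mathcomp Require Import all_classical all_reals all_analysis.
Set Implicit Arguments. Unset Strict Implicit. Unset Printing Implicit Defensive.
Import Order.TTheory GRing.Theory Num.Theory.
Local Open Scope classical_set_scope.
Local Open Scope ring_scope.

(* Indexing convention: Y k (k : nat) stands for the paper's Y_{k+1}.
   The family (Y k)_k is i.i.d. *)

Definition mutually_independent d (T : measurableType d) (R : realType)
  (P : probability T R) (Y : nat -> T -> R) : Prop :=
  forall (s : seq nat) (B : nat -> set R), uniq s ->
    (forall i, measurable (B i)) ->
    P (\bigcap_(i in [set` s]) (Y i @^-1` B i)) =
    (\prod_(i <- s) P (Y i @^-1` B i))%E.

Definition identically_distributed d (T : measurableType d) (R : realType)
  (P : probability T R) (Y : nat -> T -> R) : Prop :=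
  forall n (B : set R), measurable B ->
    P (Y n @^-1` B) = P (Y 0%N @^-1` B).

Definition nondegenerate_rv d (T : measurableType d) (R : realType)
  (P : probability T R) (Z : T -> R) : Prop :=
  ~ exists c : R, P (Z @^-1` [set c]) = 1%E.

(* ar2_pair a1 a2 Y n t = (X_n(t), X_{n-1}(t)), with X_0 = X_{-1} = 0 and
   X_{m+1} = a1 X_m + a2 X_{m-1} + Y_{m+1}  (paper's Y_{m+1} is Y m here) *)
Fixpoint ar2_pair (R : realType) (T : Type) (a1 a2 : R) (Y : nat -> T -> R)
  (n : nat) (t : T) : R * R :=
  match n with
  | 0%N => (0, 0)
  | m.+1 => let: (x, xp) := ar2_pair a1 a2 Y m t in
            (a1 * x + a2 * xp + Y m t, x)
  end.

Definition ar2 (R : realType) (T : Type) (a1 a2 : R) (Y : nat -> T -> R)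
  (n : nat) (t : T) : R := (ar2_pair a1 a2 Y n t).1.

Definition pN d (T : measurableType d) (R : realType) (P : probability T R)
  (a1 a2 : R) (Y : nat -> T -> R) (x : R) (N : nat) : R :=
  fine (P [set t | forall n : nat, (1 <= n <= N)%N -> ar2 a1 a2 Y n t <= x]).

(* Main.v *)
(** Let [S n] be the random walk with steps [Y]. Since [a1 + a2 = 1],
    [X n + a2 X (n-1) = S n], so that for [a2 > 0] the event [X <= x] forces
    [S <= (1 + a2) x], and for [a2 < 0] the event [S <= 0] forces [X <= x].
    It remains to bound [P (M n <= x)], where [M n = max (S 0, ..., S n)].

    Upper bound: [M (n+1)] has the law of [max (0, Y + M n)] with [Y]
    independent of [M n]. Hence [E (M n)^2 <= n E Y^2], so [E (M n) = O(sqrt n)],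
    while [E M (n+1) >= E M n + e P (Y <= -e) P (M n <= 0)]. Summing, the
    nonincreasing sequence [P (M n <= 0)] has partial sums [O(sqrt n)], hence is
    [O(n^(-1/2))]. A level [x > 0] is reduced to [0] by finitely many steps
    [Y <= -e].

    Lower bound: let [a k = P (S 1, ..., S k >= 0)] and
    [b k = P (S 1, ..., S k < 0)]. Splitting at the last maximum of the walk and
    reversing time before it gives [sum_k a (n-k) b k = 1]. Both sequences are
    [O(n^(-1/2))] by the upper bound, so in this sum for [n = (l+1) m] with [l]
    large the indices [k < m] contribute at most 1/2, and the others at most
    [O(sqrt n) b m]. *)
Require Import Defs.
From HB Require Import structures.
From mathcomp Require Import all_boot all_order all_algebra.
From mathcomp Require Import all_classical all_reals all_analysis.
From mathcomp Require Import lebesgue_integral probability measurable_realfun.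
From mathcomp Require Import ring lra zify.
Import Order.TTheory GRing.Theory Num.Theory.
Local Open Scope classical_set_scope.
Local Open Scope ring_scope.

Set Implicit Arguments.
Unset Strict Implicit.
Unset Printing Implicit Defensive.

Definition mfun_of d d' (T : measurableType d) (T' : measurableType d')
    (f : T -> T') (mf : measurable_fun setT f) : {mfun T >-> T'} :=
  HB.pack f (isMeasurableFun.Build _ _ _ _ f mf).

Definition box {R : realType} (B : nat -> set R) : set (nat -> R) :=
  [set y | forall i, B i (y i)].

Definition cylinder {R : realType} : set (set (nat -> R)) :=
  [set box B | B in [set B | (forall i, measurable (B i)) /\
                             exists n, forall i, (n <= i)%N -> B i = setT]].

Definition Rseq (R : realType) : Type := nat -> R.

HB.instance Definition _ (R : realType) := gen_eqMixin (Rseq R).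
HB.instance Definition _ (R : realType) := gen_choiceMixin (Rseq R).
HB.instance Definition _ (R : realType) :=
  isPointed.Build (Rseq R) (fun=> 0).
HB.instance Definition _ (R : realType) :=
  @isMeasurable.Build (sigma_display (@cylinder R)) (Rseq R)
    <<s @cylinder R >> (@sigma_algebra0 _ setT cylinder) (@sigma_algebraC (Rseq R) cylinder)
    (@sigma_algebra_bigcup _ setT cylinder).

Section sequence_space.
Context {R : realType}.
Implicit Types (B : nat -> set R) (y : nat -> R).

Lemma setI_closed_cylinder : setI_closed (@cylinder R).
Proof.
move=> _ _ [B [mB [n Bn]] <-] [C [mC [m Cm]] <-].
exists (fun i => B i `&` C i); last first.
  apply/seteqP; split => y /=; first by move=> H; split=> i; case: (H i).
  by move=> [H K] i; split.
split; first by move=> i; exact: measurableI.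
exists (maxn n m) => i; rewrite geq_max => /andP[ni mi].
by rewrite Bn// Cm// setIT.
Qed.

Lemma cylinder_setT : @cylinder R setT.
Proof.
exists (fun=> setT); last by apply/seteqP; split.
by split=> //; exists 0%N.
Qed.

Lemma measurable_cylinder (A : set (Rseq R)) : cylinder A -> measurable A.
Proof. exact: sub_sigma_algebra. Qed.

Lemma measurable_coord i : measurable_fun setT (fun y : Rseq R => (y : nat -> R) i).
Proof.
move=> _ B mB; rewrite setTI; apply: measurable_cylinder.
exists (fun j => if j == i then B else setT).
  split; first by move=> j; case: ifP.
  by exists i.+1 => j ij; rewrite gtn_eqF.
apply/seteqP; split => y /=; first by move/(_ i); rewrite eqxx.
by move=> By j; case: eqP => // ->.
Qed.

Lemma measurable_RseqP d (T : measurableType d) (f : T -> Rseq R) :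
  (forall i, measurable_fun setT (fun t => (f t : nat -> R) i)) ->
  measurable_fun setT f.
Proof.
move=> mf; apply: (@measurability _ _ T (Rseq R) setT f cylinder) => //.
move=> _ [_ [B [mB _] <-] <-]; rewrite setTI.
rewrite (_ : _ @^-1` _ =
    \bigcap_i ((fun t => (f t : nat -> R) i) @^-1` B i)); last first.
  by apply/seteqP; split=> t /= H i; [move=> _|]; exact: H.
apply: bigcapT_measurable => i.
by rewrite -[X in measurable X]setTI; exact: mf.
Qed.

Lemma Rseq_measure_unique (m1 m2 : {measure set (Rseq R) -> \bar R}) :
  (m1 setT < +oo)%E -> (forall A, cylinder A -> m1 A = m2 A) ->
  forall A, measurable A -> m1 A = m2 A.
Proof.
move=> m1oo m12 A mA.
apply: (@measure_unique _ R (Rseq R) cylinder (fun=> setT)) => //.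
- exact: setI_closed_cylinder.
- by move=> _; exact: cylinder_setT.
- by rewrite bigcup_const.
Qed.

Lemma Rseq_indep d (T : measurableType d) (P : probability T R)
    (f : T -> Rseq R) (F : set T) :
  measurable_fun setT f -> measurable F ->
  (forall A, cylinder A -> P (f @^-1` A `&` F) = (P (f @^-1` A) * P F)%E) ->
  forall A, measurable A -> P (f @^-1` A `&` F) = (P (f @^-1` A) * P F)%E.
Proof.
move=> mf mF h A mA.
pose X : {RV P >-> Rseq R} := mfun_of mf.
pose p : {nonneg R} := NngNum (fine_ge0 (measure_ge0 P F)).
have PF : P F = p%:num%:E by rewrite /= fineK// fin_num_measure.
have := @Rseq_measure_unique (pushforward (mrestr P mF) X)
  (mscale p (distribution P X)).
rewrite /= /pushforward /mscale /mrestr /distribution/= /pushforward/=.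
move=> /(_ mf _ _ A mA) ->.
- by rewrite PF muleC.
- apply: (@le_lt_trans _ _ 1%E); last by rewrite ltry.
  by apply: probability_le1; rewrite setTI.
- by move=> C cC; rewrite h// PF muleC.
Qed.

End sequence_space.

Definition iid_law {R : realType} (mu : probability R R)
    (Q : probability (Rseq R) R) : Prop :=
  forall (s : seq nat) (B : nat -> set R), uniq s ->
    (forall i, measurable (B i)) ->
    Q [set y | forall i, i \in s -> B i (y i)] = (\prod_(i <- s) mu (B i))%E.

Definition reindex {R : realType} (s : nat -> nat) (y : Rseq R) : Rseq R :=
  fun i => y (s i).

Definition map_coord {R : realType} (g : nat -> R -> R) (y : Rseq R) : Rseq R :=
  fun i => g i (y i).

Lemma measurable_reindex {R : realType} (s : nat -> nat) :
  measurable_fun setT (@reindex R s).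
Proof. by apply: measurable_RseqP => i; exact: measurable_coord. Qed.

Lemma measurable_map_coord {R : realType} (g : nat -> R -> R) :
  (forall i, measurable_fun setT (g i)) -> measurable_fun setT (map_coord g).
Proof.
move=> mg; apply: measurable_RseqP => i.
by apply: (measurableT_comp (mg i)); exact: measurable_coord.
Qed.

Section iid.
Context {R : realType} (mu : probability R R) (Q : probability (Rseq R) R).
Hypothesis muQ : iid_law mu Q.

Lemma iid_box n (B : nat -> set R) : (forall i, measurable (B i)) ->
  (forall i, (n <= i)%N -> B i = setT) ->
  Q (box B) = (\prod_(0 <= i < n) mu (B i))%E.
Proof.
move=> mB Bn; rewrite /index_iota subn0 -muQ ?iota_uniq//; congr (Q _).
apply/seteqP; split => y /= H i; first by move=> _; exact: H.
have [ni|ni] := leqP n i; first by rewrite Bn.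
by apply: H; rewrite mem_iota.
Qed.

Lemma iid_coord i (B : set R) : measurable B -> Q [set y | B (y i)] = mu B.
Proof.
move=> mB; have := @muQ [:: i] (fun=> B) isT (fun=> mB).
rewrite big_seq1 => <-; congr (Q _); apply/seteqP; split => y /=.
  by move=> By j; rewrite inE => /eqP->.
by apply; rewrite inE.
Qed.

Lemma iid_reindex (s : nat -> nat) : injective s ->
  forall A, measurable A -> Q (reindex s @^-1` A) = Q A.
Proof.
move=> injs.
pose X : {RV Q >-> Rseq R} := mfun_of (measurable_reindex s).
apply: (@Rseq_measure_unique R (distribution Q X) Q).
  by rewrite /= /distribution /pushforward preimage_setT probability_setT ltry.
move=> _ [B [mB [n Bn]] <-]; rewrite /distribution /pushforward/=.
rewrite (iid_box mB Bn) /index_iota subn0.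
set r := map s (iota 0 n).
have index_r j : (j < n)%N -> index (s j) r = j.
  move=> jn; rewrite index_map//.
  rewrite -[X in index X _](@nth_iota 0 0 n j jn).
  by rewrite index_uniq ?size_iota ?iota_uniq.
transitivity (Q [set y | forall i, i \in r -> B (index i r) (y i)]).
  congr (Q _); apply/seteqP; split => y /= H i.
    by move=> /mapP[j]; rewrite mem_iota => /andP[_ jn] ->; rewrite index_r.
  have [ni|ni] := leqP n i; first by rewrite Bn.
  have : s i \in r by apply/map_f; rewrite mem_iota.
  by move=> /H; rewrite index_r.
rewrite (muQ (B := fun i => B (index i r))) ?map_inj_uniq ?iota_uniq//.
rewrite big_map big_seq [RHS]big_seq; apply: eq_bigr => j.
by rewrite mem_iota => /andP[_ jn]; rewrite index_r.
Qed.

(* It suffices to treat cylinders, where the product formula applies because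
   a constant map has preimages [set0] and [setT] only. *)
Lemma iid_indep (g h : nat -> R -> R) (A B : set (Rseq R)) :
  (forall i, measurable_fun setT (g i)) ->
  (forall i, measurable_fun setT (h i)) ->
  (forall i, (exists c, g i = cst c) \/ (exists c, h i = cst c)) ->
  measurable A -> measurable B ->
  Q (map_coord g @^-1` A `&` map_coord h @^-1` B) =
  (Q (map_coord g @^-1` A) * Q (map_coord h @^-1` B))%E.
Proof.
move=> mg mh gh mA mB.
have Mg := measurable_map_coord mg; have Mh := measurable_map_coord mh.
have mgB C : measurable C -> measurable (map_coord g @^-1` C).
  by move=> mC; rewrite -[X in measurable X]setTI; exact: Mg.
have mhB C : measurable C -> measurable (map_coord h @^-1` C).
  by move=> mC; rewrite -[X in measurable X]setTI; exact: Mh.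
have mpre (f : R -> R) (C : set R) : measurable_fun setT f -> measurable C ->
    measurable (f @^-1` C).
  by move=> mf mC; rewrite -[X in measurable X]setTI; exact: mf.
apply: Rseq_indep => //; first exact: mhB.
move=> C cC; rewrite setIC muleC; move: B mB.
apply: Rseq_indep => //; first by apply: mgB; exact: measurable_cylinder.
move=> D cD; case: cC cD => [b [mb [n bn]] <-] [c [mc [m cm]] <-].
have pre_box f (e : nat -> set R) :
    map_coord f @^-1` box e = box (fun i => f i @^-1` e i).
  by apply/seteqP; split.
rewrite !pre_box.
rewrite (_ : _ `&` _ = box (fun i => h i @^-1` c i `&` g i @^-1` b i)); last first.
  apply/seteqP; split => y /=; first by move=> [H K] i; split.
  by move=> H; split=> i; case: (H i).
rewrite (@iid_box (maxn n m)); last 2 first.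
  by move=> i; apply: measurableI; exact: mpre.
  move=> i; rewrite geq_max => /andP[ni mi].
  by rewrite bn// cm// !preimage_setT setIT.
rewrite (@iid_box (maxn n m)); last 2 first.
  by move=> i; exact: mpre.
  by move=> i; rewrite geq_max => /andP[ni mi]; rewrite cm// preimage_setT.
rewrite (@iid_box (maxn n m)); last 2 first.
  by move=> i; exact: mpre.
  by move=> i; rewrite geq_max => /andP[ni mi]; rewrite bn// preimage_setT.
rewrite -big_split/=; apply: eq_bigr => i _.
have cstE (k : R) (E : set R) : (cst k : R -> R) @^-1` E = setT \/
    (cst k : R -> R) @^-1` E = set0.
  have [Ek|Ek] := pselect (E k); [left|right]; apply/seteqP; split=> //.
case: (gh i) => -[k ->].
  case: (cstE k (b i)) => ->; first by rewrite setIT probability_setT mule1.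
  by rewrite setI0 measure0 mule0.
case: (cstE k (c i)) => ->; first by rewrite setTI probability_setT mul1e.
by rewrite set0I measure0 mul0e.
Qed.

End iid.

Definition psum {R : realType} (y : nat -> R) (n : nat) : R := \sum_(i < n) y i.

(* The maximum of [psum y k] over [0 <= k <= n], unfolded from the first step. *)
Fixpoint smax {R : realType} (n : nat) (y : Rseq R) : R :=
  if n is m.+1 then Num.max 0 (y 0%N + smax m (reindex succn y)) else 0.

Section smax_theory.
Context {R : realType}.
Implicit Types (y : Rseq R).

Lemma psumS y n : psum y n.+1 = y 0%N + psum (reindex succn y) n.
Proof. by rewrite /psum big_ord_recl. Qed.

Lemma smax_leP n y x :
  (smax n y <= x) <-> (forall k, (k <= n)%N -> psum y k <= x).
Proof.
elim: n y x => [|n ih] y x /=.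
  split=> [x0 k|/(_ 0%N (leqnn _))]; last by rewrite /psum big_ord0.
  by rewrite leqn0 => /eqP ->; rewrite /psum big_ord0.
rewrite ge_max; split=> [/andP[x0]|H].
  rewrite -lerBrDl => /ih H [|k] kn; first by rewrite /psum big_ord0.
  by rewrite psumS -lerBrDl; exact: H.
apply/andP; split; first by have := H 0%N isT; rewrite /psum big_ord0.
by rewrite -lerBrDl; apply/ih => k kn; rewrite lerBrDl -psumS; exact: H.
Qed.

Lemma smax_ge0 n y : 0 <= smax n y.
Proof. by case: n => //= n; rewrite le_max lexx. Qed.

Lemma measurable_smax n : measurable_fun setT (@smax R n).
Proof.
elim: n => [|n ih] /=; first exact: measurable_cst.
apply: measurable_maxr; first exact: measurable_cst.
apply: measurable_funD; first exact: measurable_coord.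
exact: (measurableT_comp ih (measurable_reindex _)).
Qed.

Lemma measurable_psum n : measurable_fun setT (fun y : Rseq R => psum y n).
Proof. by apply: measurable_sum => i; exact: measurable_coord. Qed.

Lemma measurable_smax_le n x : measurable [set y : Rseq R | smax n y <= x].
Proof.
rewrite -[X in measurable X]setTI; apply: measurable_fun_le => //.
exact: measurable_smax.
Qed.

End smax_theory.

Section smax_iid.
Context {R : realType} (mu : probability R R) (Q : probability (Rseq R) R).
Hypothesis muQ : iid_law mu Q.

Lemma smax_step_indep n (A B : set R) : measurable A -> measurable B ->
  Q [set y | A (y 0%N) /\ B (smax n (reindex succn y))] =
  (mu A * Q [set y | B (smax n y)])%E.
Proof.
move=> mA mB.
have mB' : measurable [set y : Rseq R | B (smax n y)].
  by rewrite -[X in measurable X]setTI; exact: measurable_smax.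
have mB'' : measurable [set y : Rseq R | B (smax n (reindex succn y))].
  rewrite -[X in measurable X]setTI.
  exact: (measurableT_comp (measurable_smax n) (measurable_reindex succn)).
have mA' : measurable [set y : Rseq R | A (y 0%N)].
  by rewrite -[X in measurable X]setTI; exact: measurable_coord.
pose g i : R -> R := if i == 0%N then id else cst 0.
pose h i : R -> R := if i == 0%N then cst 0 else id.
have hE y : reindex succn (map_coord h y) = reindex succn y by exact/funext.
have := @iid_indep _ _ _ muQ g h [set y | A (y 0%N)]
  [set y | B (smax n (reindex succn y))].
rewrite (_ : map_coord g @^-1` _ = [set y | A (y 0%N)])//.
rewrite (_ : map_coord h @^-1` _ =
    [set y | B (smax n (reindex succn y))]); last first.
  by apply/seteqP; split=> y /=; rewrite hE.
move=> /= ->//.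
- congr (_ * _)%E; first exact: iid_coord.
  by rewrite -(iid_reindex muQ succn_inj mB').
- by move=> i; rewrite /g; case: ifP => _; [exact: measurable_id|exact: measurable_cst].
- by move=> i; rewrite /h; case: ifP => _; [exact: measurable_cst|exact: measurable_id].
- by move=> i; rewrite /g /h; case: ifP => _; [right|left]; exists 0.
Qed.

Lemma ge0_integral_smax_step n (f : R * R -> \bar R) :
  measurable_fun setT f -> (forall z, 0 <= f z)%E ->
  (\int[Q]_y f (y 0%N, smax n (reindex succn y)) =
   \int[Q]_y \int[mu]_x f (x, smax n y))%E.
Proof.
move=> mf f0.
pose X (y : Rseq R) : R * R := (y 0%N, smax n (reindex succn y)).
have mX : measurable_fun setT X.
  apply: measurable_fun_pair; first exact: measurable_coord.
  exact: (measurableT_comp (measurable_smax n) (measurable_reindex succn)).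
pose X' : {RV Q >-> (R * R)%type} := mfun_of mX.
pose M : {RV Q >-> R} := mfun_of (measurable_smax n).
transitivity (\int[distribution Q X']_z f z)%E.
  by rewrite ge0_integral_distribution.
transitivity (\int[mu \x distribution Q M]_z f z)%E.
  apply: eq_measure_integral => A mA _; apply/esym.
  apply: (product_measure_unique (m' := distribution Q X')) => // B C mB mC.
  exact: smax_step_indep.
rewrite fubini_tonelli2// ge0_integral_distribution//.
- exact: measurable_fun_fubini_tonelli_G.
- by move=> y; apply: integral_ge0 => x _.
Qed.

End smax_iid.

Definition centered_law {R : realType} (mu : probability R R) (v : R) : Prop :=
  (\int[mu]_x x%:E = 0)%E /\ (\int[mu]_x (x ^+ 2)%:E = v%:E)%E.

Lemma integrable_of_sqr d (T : measurableType d) (R : realType)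
    (P : probability T R) (X : T -> R) : measurable_fun setT X ->
  (\int[P]_t (X t ^+ 2)%:E < +oo)%E -> P.-integrable setT (fun t => (X t)%:E).
Proof.
move=> mX X2.
apply: (@le_integrable _ _ _ _ _ measurableT _
    (fun t => (1%:E + (X t ^+ 2)%:E)%E)).
- exact/measurable_EFinP.
- move=> t _; rewrite -EFinD !abse_EFin lee_fin [X in _ <= X]ger0_norm.
    by rewrite ler_norml; apply/andP; split; nra.
  by rewrite addr_ge0// sqr_ge0.
- apply: integrableD => //; first exact: (finite_measure_integrable_cst _ 1).
  apply/integrableP; split.
    by apply/measurable_EFinP; exact: measurable_funX.
  by under eq_integral do rewrite gee0_abs ?lee_fin ?sqr_ge0//.
Qed.

Section centered.
Context {R : realType} (mu : probability R R) (v : R).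
Hypothesis muv : centered_law mu v.

Lemma centered_integrable_sqr :
  mu.-integrable setT (fun x : R => (x ^+ 2)%:E).
Proof.
have [_ mu2] := muv; apply/integrableP; split.
  by apply/measurable_EFinP; exact: exprn_measurable.
under eq_integral do rewrite gee0_abs ?lee_fin ?sqr_ge0//.
by rewrite mu2 ltry.
Qed.

Lemma centered_integrable : mu.-integrable setT (fun x : R => x%:E).
Proof.
have [_ mu2] := muv.
by apply: integrable_of_sqr; [exact: measurable_id|rewrite mu2 ltry].
Qed.

Lemma centered_moment2_shift (m : R) :
  (\int[mu]_x ((x + m) ^+ 2)%:E = (v + m ^+ 2)%:E)%E.
Proof.
have [mu1 mu2] := muv.
have i1 := centered_integrable; have i2 := centered_integrable_sqr.
have ic : mu.-integrable setT (cst (m ^+ 2)%:E).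
  exact: (finite_measure_integrable_cst _ (m ^+ 2)).
have iz : mu.-integrable setT (fun x : R => ((2 * m)%:E * x%:E)%E).
  exact: integrableZl.
transitivity (\int[mu]_x ((x ^+ 2)%:E + ((2 * m)%:E * x%:E + (m ^+ 2)%:E)))%E.
  by apply: eq_integral => x _; rewrite -EFinM -!EFinD; congr EFin; ring.
rewrite integralD//; last exact: integrableD.
rewrite integralD// integralZl// mu1 mule0 add0e mu2.
by rewrite (integral_cst mu measurableT (m ^+ 2)%:E)/= probability_setT mule1.
Qed.

Lemma measurable_le_cst (e : R) : measurable [set x : R | x <= e].
Proof.
rewrite -[X in measurable X]setTI; apply: measurable_fun_le => //.
Qed.

Lemma centered_neg_mass : 0 < v ->
  exists2 e : R, 0 < e & (0 < mu [set x | (x <= - e)%R])%E.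
Proof.
move=> v0; have [mu1 mu2] := muv.
apply: contrapT => H.
have null e : 0 < e -> mu [set x | x <= - e] = 0.
  move=> e0; apply/eqP; rewrite eq_le measure_ge0 andbT leNgt.
  by apply/negP => K; apply: H; exists e.
have neg0 : mu.-negligible [set x : R | x < 0].
  rewrite (_ : [set x | x < 0] =
    \bigcup_k [set x : R | x <= - (k.+1%:R)^-1]); last first.
    apply/seteqP; split => x /=; last first.
      by move=> [k _] /=; move/le_lt_trans; apply; rewrite oppr_lt0 invr_gt0.
    move=> x0; exists (Num.trunc (- x)^-1) => //=.
    rewrite lerNr -[leRHS]invrK lef_pV2 ?posrE ?invr_gt0 ?oppr_gt0//.
    by apply/ltW/truncnS_gt.
  apply: negligible_bigcup => k; exists [set x | x <= - (k.+1%:R)^-1].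
  by split=> //; [exact: measurable_le_cst|apply: null; rewrite invr_gt0].
have xabs : (\int[mu]_x `|x%:E| = 0)%E.
  rewrite -mu1; apply: ae_eq_integral => //.
    by apply: measurableT_comp => //; exact: EFin_measurable.
  apply: negligibleS neg0 => x /= nx; rewrite ltNge; apply/negP => x0.
  by apply: nx => _; rewrite ger0_norm.
have := v0; rewrite -lte_fin -mu2.
rewrite (_ : integral _ _ _ = 0%E) ?ltxx//.
rewrite -(integral0 mu setT); apply: ae_eq_integral => //.
- by apply/measurable_EFinP; exact: exprn_measurable.
- have /ae_eq_integral_abs : measurable_fun [set: R] (EFin : R -> \bar R).
    by apply/measurable_EFinP; exact: measurable_id.
  move=> /(_ mu measurableT) [/(_ xabs) + _].
  apply: filterS => x /= /(_ I) [->] _; by rewrite expr0n.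
Qed.

Lemma centered_drift (e m : R) : 0 < e -> 0 <= m ->
  ((m + e * fine (mu [set x | (x <= - e)%R]) * (m <= 0)%R%:R)%:E
    <= \int[mu]_x (Num.max 0 (x + m))%:E)%E.
Proof.
move=> e0 m0; have [mu1 mu2] := muv.
have i1 := centered_integrable.
have ic : mu.-integrable setT (cst m%:E).
  exact: (finite_measure_integrable_cst _ m).
have mA := measurable_le_cst (- e).
set c := e * (m <= 0)%R%:R.
have iA : mu.-integrable setT (fun x : R => (c%:E * (\1_[set x : R | (x <= - e)%R] x)%:E)%E).
  by apply: integrableZl => //; exact: integrable_indic.
have -> : (m + e * fine (mu [set x | (x <= - e)%R]) * (m <= 0)%R%:R)%:E =
   (\int[mu]_x (x%:E + (m%:E + c%:E * (\1_[set x : R | (x <= - e)%R] x)%:E)))%E.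
  rewrite integralD//; last exact: integrableD.
  rewrite integralD// mu1 add0e integralZl//; last exact: integrable_indic.
  rewrite integral_indic// setIT.
  rewrite (integral_cst mu measurableT m%:E)/= probability_setT mule1.
  rewrite -[X in (_ * X)%E]fineK ?fin_num_measure// -EFinM -EFinD.
  by congr EFin; rewrite /c; ring.
apply: le_integral => //.
- by apply: integrableD => //; exact: integrableD.
- apply: (@le_integrable _ _ _ _ _ measurableT _
      (fun x : R => (`|x%:E| + m%:E)%E)).
  + apply/measurable_EFinP; apply: measurable_maxr => //.
    exact: measurable_funD.
  + move=> x _; rewrite /= lee_fin.
    rewrite [X in X <= _]ger0_norm ?le_max ?lexx//.
    rewrite [X in _ <= X]ger0_norm ?addr_ge0// ge_max addr_ge0//=.
    by rewrite lerD2r ler_norm.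
  + by apply: integrableD => //; exact: integrable_abse.
- move=> x _; rewrite -EFinM -!EFinD lee_fin indicE /c.
  have [xe|xe] := boolP (x \in _); last first.
    by rewrite mulr0 addr0 le_max lexx orbT.
  move: xe; rewrite inE/= => xe; rewrite mulr1.
  have [m0'|_] := boolP (m <= 0); last by rewrite mulr0 addr0 le_max lexx orbT.
  by rewrite mulr1 le_max; apply/orP; left; lra.
Qed.

End centered.

Definition stay {R : realType} (Q : probability (Rseq R) R) (n : nat) (x : R) : R :=
  fine (Q [set y | smax n y <= x]).

Section stay_basic.
Context {R : realType} (Q : probability (Rseq R) R).

Lemma stayE n x : (stay Q n x)%:E = Q [set y | smax n y <= x].
Proof. by rewrite /stay fineK// fin_num_measure//; exact: measurable_smax_le. Qed.

Lemma stay_ge0 n x : 0 <= stay Q n x.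
Proof. exact: fine_ge0. Qed.

Lemma stay_antitone n m x : (n <= m)%N -> stay Q m x <= stay Q n x.
Proof.
move=> nm; rewrite -lee_fin !stayE; apply: le_measure; rewrite ?inE.
- exact: measurable_smax_le.
- exact: measurable_smax_le.
move=> y /= /smax_leP H; apply/smax_leP => k kn; apply: H.
exact: leq_trans nm.
Qed.

End stay_basic.

Section stay_upper_bound.
Context {R : realType} (mu : probability R R) (Q : probability (Rseq R) R).
Variable v : R.
Hypotheses (muQ : iid_law mu Q) (muv : centered_law mu v) (v0 : 0 < v).

Let msmax n := @measurable_smax R n.

Lemma smax_moment2 n : (\int[Q]_y (smax n y ^+ 2)%:E <= (n%:R * v)%:E)%E.
Proof.
elim: n => [|n ih].
  rewrite /= mul0r; under eq_integral do rewrite expr0n/=.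
  by rewrite integral0.
pose f (z : R * R) := (Num.max 0 (z.1 + z.2) ^+ 2)%:E.
have mf : measurable_fun setT f.
  apply/measurable_EFinP; apply: measurable_funX; apply: measurable_maxr => //.
  by apply: measurable_funD; [exact: measurable_fst|exact: measurable_snd].
have f0 z : (0 <= f z)%E by rewrite lee_fin sqr_ge0.
rewrite [leLHS](ge0_integral_smax_step muQ n mf f0).
apply: (@le_trans _ _ (\int[Q]_y (v%:E + (smax n y ^+ 2)%:E))%E).
  apply: ge0_le_integral => //.
  - by move=> y _; apply: integral_ge0 => x _; exact: f0.
  - exact: (measurableT_comp (measurable_fun_fubini_tonelli_G (m1 := mu) f mf f0)).
  - apply/measurable_EFinP; apply: measurable_funD => //.
    exact: measurable_funX.
  move=> y _; rewrite -EFinD -(centered_moment2_shift muv).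
  apply: ge0_le_integral => //.
  - exact: measurableT_comp.
  - apply/measurable_EFinP; apply: measurable_funX; exact: measurable_funD.
  move=> x _; rewrite lee_fin/=.
  have [h|h] := leP 0 (x + smax n y); first by [].
  by rewrite expr0n/= sqr_ge0.
rewrite ge0_integralD//; last 3 first.
- by move=> y _; rewrite lee_fin ltW.
- by move=> y _; rewrite lee_fin sqr_ge0.
- apply/measurable_EFinP; exact: measurable_funX.
rewrite (integral_cst Q measurableT v%:E)/= probability_setT mule1.
rewrite -natr1 mulrDl mul1r EFinD [leRHS]addeC.
by apply: leeD.
Qed.

Lemma smax_moment1 (e : R) n : 0 < e ->
  ((e * fine (mu [set x | (x <= - e)%R]) * \sum_(k < n) stay Q k 0)%:E
    <= \int[Q]_y (smax n y)%:E)%E.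
Proof.
move=> e0; set p := fine _.
have p0 : 0 <= p by exact: fine_ge0.
elim: n => [|n ih].
  by rewrite big_ord0 mulr0 /= integral0.
pose f (z : R * R) := (Num.max 0 (z.1 + z.2))%:E.
have mf : measurable_fun setT f.
  apply/measurable_EFinP; apply: measurable_maxr => //.
  by apply: measurable_funD; [exact: measurable_fst|exact: measurable_snd].
have f0 z : (0 <= f z)%E by rewrite lee_fin le_max lexx.
rewrite [leRHS](ge0_integral_smax_step muQ n mf f0).
set A := [set y : Rseq R | smax n y <= 0].
have mA : measurable A by exact: measurable_smax_le.
apply: (@le_trans _ _
  (\int[Q]_y ((smax n y)%:E + (e * p)%:E * (\1_A y)%:E))%E); last first.
  apply: ge0_le_integral => //.
  - move=> y _; rewrite -EFinM -EFinD lee_fin.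
    by rewrite addr_ge0 ?smax_ge0// mulr_ge0// mulr_ge0// ltW.
  - apply/measurable_EFinP; apply: measurable_funD => //.
    apply: measurable_funM => //.
  - exact: (measurableT_comp (measurable_fun_fubini_tonelli_G (m1 := mu) f mf f0)).
  move=> y _; have := centered_drift muv e0 (smax_ge0 n y).
  rewrite -/p -EFinM -EFinD indicE; congr (_ <= _)%E; congr (_ + _ * _)%:E.
  by congr (nat_of_bool _)%:R; apply/idP/idP; rewrite inE.
rewrite ge0_integralD//; last 4 first.
- by move=> y _; rewrite lee_fin smax_ge0.
- exact/measurable_EFinP.
- by move=> y _; rewrite -EFinM lee_fin mulr_ge0// mulr_ge0// ltW.
- by apply/measurable_EFinP; apply: measurable_funM.
rewrite ge0_integralZl_EFin//; last 2 first.
- by apply/measurable_EFinP.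
- by rewrite mulr_ge0// ltW.
rewrite integral_indic// setIT -[X in (_ * X)%E]/(Q A) -stayE.
rewrite big_ord_recr/= mulrDr EFinD -EFinM.
exact: leeD2r.
Qed.

Lemma stay0_bound : exists2 C, 0 <= C &
  forall k, stay Q k 0 <= C / Num.sqrt k.+1%:R.
Proof.
have [e e0 pe] := centered_neg_mass muv v0.
set p := fine (mu [set x | x <= - e]).
have p0 : 0 < p.
  by rewrite fine_gt0// pe/= ltey_eq fin_num_measure//; exact: measurable_le_cst.
exists ((v + 1) / 2 / (e * p)).
  by rewrite !mulr_ge0// ?invr_ge0 ?mulr_ge0 ?addr_ge0// ltW.
move=> k; set n := k.+1; set r := Num.sqrt n%:R.
have r0 : 0 < r by rewrite sqrtr_gt0 ltr0n.
have rr : r ^+ 2 = n%:R by rewrite sqr_sqrtr.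
(* [smax n <= (smax n ^ 2 / r + r) / 2] *)
have m1 : (\int[Q]_y (smax n y)%:E <= (r * (v + 1) / 2)%:E)%E.
  apply: (@le_trans _ _
    (\int[Q]_y ((r / 2)%:E + ((2 * r)^-1)%:E * (smax n y ^+ 2)%:E))%E).
    apply: ge0_le_integral => //.
    - by move=> y _; rewrite lee_fin smax_ge0.
    - exact/measurable_EFinP.
    - apply/measurable_EFinP; apply: measurable_funD => //.
      by apply: measurable_funM => //; exact: measurable_funX.
    move=> y _; rewrite -EFinM -EFinD lee_fin -subr_ge0.
    rewrite (_ : _ - _ = (2 * r)^-1 * (smax n y - r) ^+ 2); last first.
      by field; rewrite gt_eqF.
    by rewrite mulr_ge0 ?sqr_ge0// invr_ge0 mulr_ge0// ltW.
  rewrite ge0_integralD//; last 3 first.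
  - by move=> y _; rewrite lee_fin divr_ge0// ltW.
  - by move=> y _; rewrite -EFinM lee_fin mulr_ge0 ?sqr_ge0// invr_ge0 mulr_ge0// ltW.
  - apply/measurable_EFinP; apply: measurable_funM => //; exact: measurable_funX.
  rewrite (integral_cst Q measurableT (r / 2)%:E)/= probability_setT mule1.
  rewrite ge0_integralZl_EFin//; last 3 first.
  - by move=> y _; rewrite lee_fin sqr_ge0.
  - by apply/measurable_EFinP; exact: (measurable_funX 2 (msmax n)).
  - by rewrite invr_ge0 mulr_ge0// ltW.
  apply: (@le_trans _ _ ((r / 2)%:E + ((2 * r)^-1)%:E * (n%:R * v)%:E)%E).
    apply: leeD2l; apply: lee_wpmul2l; last exact: (smax_moment2 n).
    rewrite lee_fin.
    by rewrite invr_ge0 mulr_ge0// ltW.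
  rewrite -EFinM -EFinD lee_fin -rr le_eqVlt; apply/orP; left; apply/eqP.
  by field; rewrite gt_eqF.
have := le_trans (smax_moment1 n e0) m1; rewrite lee_fin -/p => key.
have sum_ge : n%:R * stay Q k 0 <= \sum_(i < n) stay Q i 0.
  rewrite -[X in X%:R]card_ord -sumr_const mulr_suml ler_sum// => i _.
  by rewrite mul1r stay_antitone// -ltnS.
have ep0 : 0 < e * p by exact: mulr_gt0.
rewrite ler_pdivlMr// ler_pdivlMr// -(ler_pM2l r0).
apply: le_trans (_ : _ <= r * (v + 1) / 2) _; last by rewrite mulrA.
apply: le_trans key; rewrite -(ler_pM2l ep0) -rr in sum_ge.
by apply: le_trans sum_ge; rewrite le_eqVlt; apply/orP; left; apply/eqP; ring.
Qed.

Lemma stay_descent (e x : R) n : 0 <= x ->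
  fine (mu [set x | x <= - e]) * stay Q n x <= stay Q n.+1 (Num.max 0 (x - e)).
Proof.
move=> x0; have mA := measurable_le_cst (- e).
rewrite -lee_fin EFinM !stayE fineK ?fin_num_measure//.
rewrite -(smax_step_indep muQ n mA (measurable_le_cst x)).
apply: le_measure; rewrite ?inE.
- apply: measurableI; rewrite -[X in measurable X]setTI.
    exact: (measurable_coord 0 measurableT mA).
  exact: (measurableT_comp (measurable_smax n) (measurable_reindex succn)
    measurableT (measurable_le_cst x)).
- exact: measurable_smax_le.
move=> y /= [ye yx]; rewrite ge_max !le_max lexx/=; apply/orP; right; lra.
Qed.

Lemma stay_bound x : 0 <= x -> exists2 C, 0 <= C &
  forall k, stay Q k x <= C / Num.sqrt k.+1%:R.
Proof.
move=> x0; have [e e0 pe] := centered_neg_mass muv v0.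
set p := fine (mu [set x | x <= - e]).
have p0 : 0 < p.
  by rewrite fine_gt0// pe/= ltey_eq fin_num_measure//; exact: measurable_le_cst.
have [j] : exists j : nat, x <= j%:R * e.
  exists (Num.trunc (x / e)).+1; rewrite -ler_pdivrMr//.
  exact/ltW/truncnS_gt.
elim: j x x0 => [|j ih] x x0 xj.
  have -> : x = 0 by apply/eqP; rewrite eq_le x0 andbT (le_trans xj)// mul0r.
  exact: stay0_bound.
have [||C C0 HC] := ih (Num.max 0 (x - e)).
- by rewrite le_max lexx.
- rewrite ge_max mulr_ge0 ?ler0n ?(ltW e0)//=.
  by move: xj; rewrite -natr1 mulrDl mul1r; lra.
exists (C / p); first by rewrite divr_ge0// ltW.
move=> k; rewrite mulrAC ler_pdivlMr// mulrC.
apply: le_trans (stay_descent e k x0) _; apply: le_trans (HC k.+1) _.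
by rewrite ler_wpM2l// lef_pV2 ?posrE ?sqrtr_gt0 ?ltr0n// ler_sqrt ?ler_nat// ltr0n.
Qed.

End stay_upper_bound.

Section convolution.
Context {R : realType}.

Lemma sum_invsqrt_le (m : nat) :
  \sum_(0 <= j < m) (Num.sqrt j.+1%:R)^-1 <= 2 * Num.sqrt m%:R :> R.
Proof.
elim: m => [|m ih]; first by rewrite big_geq// sqrtr0 mulr0.
rewrite big_nat_recr//=; apply: le_trans (lerD ih (lexx _)) _.
set a := Num.sqrt m%:R; set b := Num.sqrt m.+1%:R.
have a0 : 0 <= a by exact: sqrtr_ge0.
have b0 : 0 < b by rewrite sqrtr_gt0 ltr0n.
have ab : a <= b by rewrite ler_sqrt ?ler0n// ler_nat.
have a2 : a ^+ 2 = m%:R by rewrite sqr_sqrtr.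
have b2 : b ^+ 2 = a ^+ 2 + 1 by rewrite a2 sqr_sqrtr// natr1.
rewrite -(ler_pM2r b0) mulrDl mulVf ?gt_eqF//; nra.
Qed.

Lemma convolution_lower_bound (a b : nat -> R) (C : R) : 0 < C ->
  (forall k, 0 <= a k <= C / Num.sqrt k.+1%:R) ->
  (forall k, 0 <= b k <= C / Num.sqrt k.+1%:R) ->
  (forall k l, (k <= l)%N -> b l <= b k) ->
  (forall n, 1 <= \sum_(0 <= j < n.+1) a (n - j)%N * b j) ->
  exists2 c, 0 < c & forall m, (0 < m)%N -> c / Num.sqrt m%:R <= b m.
Proof.
move=> C0 ha hb bdec h1.
pose l := (Num.trunc (16 * C ^+ 4)).+1.
have l0 : 0 < Num.sqrt l%:R :> R by rewrite sqrtr_gt0 ltr0n.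
have lC : 4 * C ^+ 2 <= Num.sqrt l%:R.
  have -> : 4 * C ^+ 2 = Num.sqrt ((4 * C ^+ 2) ^+ 2).
    by rewrite sqrtr_sqr ger0_norm// mulr_ge0 ?sqr_ge0.
  rewrite ler_sqrt ?ler0n// exprMn -exprM -natrX.
  exact/ltW/truncnS_gt.
have L0 : 0 < Num.sqrt l.+2%:R :> R by rewrite sqrtr_gt0 ltr0n.
exists (4 * C * Num.sqrt l.+2%:R)^-1; first by rewrite invr_gt0 !mulr_gt0.
move=> m m0; set r := Num.sqrt m%:R.
have r0 : 0 < r by rewrite sqrtr_gt0 ltr0n.
have [bm0 _] := andP (hb m).
pose n := (l.+1 * m)%N.
have := h1 n; rewrite (@big_cat_nat _ _ _ m)//=; last first.
  by rewrite ltnW// ltnS /n leq_pmull.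
set S1 := \sum_(0 <= j < m) _; set S2 := \sum_(m <= j < _) _.
have sum1 : S1 <= 2^-1.
  apply: (@le_trans _ _
    (\sum_(0 <= j < m) C / (Num.sqrt l%:R * r) * (C / Num.sqrt j.+1%:R))).
    apply: ler_sum_nat => j /andP[_ jm].
    have [a0 aC] := andP (ha (n - j)%N); have [b0 bC] := andP (hb j).
    apply: ler_pM => //; apply: (le_trans aC); rewrite ler_pM2l//.
    rewrite lef_pV2 ?posrE ?mulr_gt0 ?sqrtr_gt0 ?ltr0n//.
    rewrite -sqrtrM ?ler0n// ler_sqrt ?ler0n// -natrM ler_nat.
    by rewrite /n mulSn; lia.
  rewrite -mulr_sumr -mulr_sumr.
  apply: (@le_trans _ _ (C / (Num.sqrt l%:R * r) * (C * (2 * r)))).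
    rewrite ler_pM2l ?divr_gt0 ?mulr_gt0// ler_pM2l//; exact: sum_invsqrt_le.
  rewrite (_ : _ * _ = 2 * C ^+ 2 / Num.sqrt l%:R); last first.
    by field; rewrite !gt_eqF.
  by rewrite ler_pdivrMr//; lra.
have sum2 : S2 <= b m * (C * (2 * (Num.sqrt l.+2%:R * r))).
  apply: (@le_trans _ _ (b m * \sum_(m <= j < n.+1) a (n - j)%N)).
    rewrite mulr_sumr; apply: ler_sum_nat => j /andP[mj _].
    by rewrite mulrC ler_wpM2r ?bdec//; case/andP: (ha (n - j)%N).
  rewrite ler_wpM2l//.
  apply: (@le_trans _ _ (\sum_(0 <= j < n.+1) a (n - j)%N)).
    rewrite [leRHS](@big_cat_nat _ _ _ m)//=; last first.
      by rewrite ltnW// ltnS /n leq_pmull.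
    by rewrite lerDr sumr_ge0// => j _; case/andP: (ha (n - j)%N).
  rewrite big_nat_rev/= add0n.
  apply: (@le_trans _ _ (\sum_(0 <= j < n.+1) C / Num.sqrt j.+1%:R)).
    apply: ler_sum_nat => j /andP[_ jn]; rewrite subSS subKn//.
    by case/andP: (ha j).
  rewrite -mulr_sumr ler_pM2l//.
  apply: le_trans (sum_invsqrt_le _) _; rewrite ler_pM2l//.
  rewrite -sqrtrM ?ler0n// -natrM ler_sqrt ?ler0n// ler_nat /n !mulSn; lia.
move=> h; rewrite ler_pdivrMr// -[leLHS]mul1r ler_pdivrMr ?mulr_gt0//.
by nra.
Qed.

Lemma last_argmax (u : nat -> R) n : exists k, [/\ (k <= n)%N,
  forall j, (j <= k)%N -> u j <= u k &
  forall j, (k < j <= n)%N -> u j < u k].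
Proof.
elim: n => [|n [k [kn H1 H2]]].
  exists 0%N; split=> // j; first by rewrite leqn0 => /eqP->.
  by move=> /andP[]; case: j.
have [h|h] := leP (u k) (u n.+1).
  exists n.+1; split=> // j; last by move=> /andP[/leq_trans jn /jn]; rewrite ltnn.
  rewrite leq_eqVlt => /orP[/eqP->//|]; rewrite ltnS => jn.
  apply: le_trans h; have [jk|jk] := leqP j k; first exact: H1.
  by apply/ltW/H2; rewrite jk jn.
exists k; split=> //; first exact: leqW.
move=> j /andP[kj]; rewrite leq_eqVlt => /orP[/eqP->//|]; rewrite ltnS => jn.
by apply: H2; rewrite kj jn.
Qed.

End convolution.

Definition rev_below (k i : nat) : nat := if (i < k)%N then (k - i.+1)%N else i.

Lemma rev_below_inj k : injective (rev_below k).
Proof. by move=> i j; rewrite /rev_below; do 2 case: ltnP => ?; lia. Qed.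

Section reversal.
Context {R : realType}.
Implicit Types (y : Rseq R).

Lemma psum_recr y n : psum y n.+1 = psum y n + y n.
Proof. by rewrite /psum big_ord_recr. Qed.

Lemma psum_shift y k j : psum y (k + j) = psum y k + psum (reindex (addn k) y) j.
Proof.
elim: j => [|j ih]; first by rewrite addn0 [psum _ 0]big_ord0 addr0.
by rewrite addnS !psum_recr ih addrA.
Qed.

Lemma psum_rev y k j : (j <= k)%N ->
  psum (reindex (rev_below k) y) j = psum y k - psum y (k - j).
Proof.
elim: j => [|j ih] jk; first by rewrite subn0 subrr [psum _ 0]big_ord0.
rewrite psum_recr ih ?(ltnW jk)// /reindex /rev_below jk.
rewrite -(subnSK jk) psum_recr; ring.
Qed.

Lemma psum_opp y k : psum (map_coord (fun=> -%R) y) k = - psum y k.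
Proof. by rewrite /psum sumrN. Qed.

End reversal.

Definition opp_law {R : realType} (mu : probability R R) : probability R R :=
  distribution mu (mfun_of (@oppr_measurable R setT)).

Lemma measurable_opp_seq {R : realType} :
  measurable_fun setT (@map_coord R (fun=> -%R)).
Proof. by apply: measurable_map_coord => _; exact: oppr_measurable. Qed.

Definition opp_seq_law {R : realType} (Q : probability (Rseq R) R) :
  probability (Rseq R) R := distribution Q (mfun_of measurable_opp_seq).

Lemma iid_opp {R : realType} (mu : probability R R)
    (Q : probability (Rseq R) R) :
  iid_law mu Q -> iid_law (opp_law mu) (opp_seq_law Q).
Proof.
move=> muQ s B us mB.
have mB' i : measurable (-%R @^-1` B i).
  by rewrite -[X in measurable X]setTI; exact: oppr_measurable.
exact: (muQ s (fun i => -%R @^-1` B i) us mB').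
Qed.

Lemma centered_opp {R : realType} (mu : probability R R) (v : R) :
  centered_law mu v -> centered_law (opp_law mu) v.
Proof.
move=> muv; have [mu1 mu2] := muv; split.
  rewrite integral_distribution/=; last 2 first.
  - exact: EFin_measurable.
  - apply: eq_integrable (integrableN (centered_integrable muv)) => //.
  transitivity (\int[mu]_x ((-1)%:E * x%:E))%E.
    by apply: eq_integral => x _; rewrite -EFinM mulN1r.
  by rewrite integralZl ?mu1 ?mule0//; exact: (centered_integrable muv).
rewrite ge0_integral_distribution; last 2 first.
- by apply/measurable_EFinP; exact: exprn_measurable.
- by move=> x; rewrite lee_fin sqr_ge0.
by rewrite -mu2; apply: eq_integral => x _ /=; rewrite sqrrN.
Qed.

Section walk_negative.
Context {R : realType} (mu : probability R R) (Q : probability (Rseq R) R).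
Hypothesis muQ : iid_law mu Q.

Definition walk_neg n : set (Rseq R) :=
  [set y | forall j, (0 < j <= n)%N -> psum y j < 0].

Definition walk_top k : set (Rseq R) :=
  [set y | forall j, (j <= k)%N -> psum y j <= psum y k].

Lemma measurable_walk_neg n : measurable (walk_neg n).
Proof.
rewrite (_ : walk_neg n = \bigcap_j
    [set y | (0 < j <= n)%N -> psum y j < 0]); last first.
  by apply/seteqP; split=> y /= H j; [move=> _|]; exact: H.
apply: bigcapT_measurable => j; have [jn|jn] := boolP (0 < j <= n)%N.
  rewrite (_ : mkset _ = ~` [set y | 0 <= psum y j]); last first.
    apply/seteqP; split=> y /= H; first by apply/negP; rewrite -ltNge; exact: H.
    by move=> _; rewrite ltNge; exact/negP.
  apply: measurableC; rewrite -[X in measurable X]setTI.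
  by apply: measurable_fun_le => //; exact: measurable_psum.
by rewrite (_ : mkset _ = setT)//; apply/seteqP; split.
Qed.

Lemma measurable_walk_top k : measurable (walk_top k).
Proof.
rewrite (_ : walk_top k = \bigcap_j
    [set y | (j <= k)%N -> psum y j <= psum y k]); last first.
  by apply/seteqP; split=> y /= H j; [move=> _|]; exact: H.
apply: bigcapT_measurable => j; have [jk|jk] := boolP (j <= k)%N.
  rewrite (_ : mkset _ = [set y | psum y j <= psum y k]); last first.
    by apply/seteqP; split=> y /= H; [exact: H|move=> _].
  rewrite -[X in measurable X]setTI; apply: measurable_fun_le => //;
  exact: measurable_psum.
by rewrite (_ : mkset _ = setT)//; apply/seteqP; split.
Qed.

(* Reading the first [k] steps backwards turns "the walk is at its maximum at
   time [k]" into "the walk is nonnegative up to time [k]". *)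
Lemma walk_topE k : Q (walk_top k) = (stay (opp_seq_law Q) k 0)%:E.
Proof.
rewrite stayE.
set A := map_coord (fun=> -%R) @^-1` [set y : Rseq R | smax k y <= 0].
have mA : measurable A.
  rewrite -[X in measurable X]setTI.
  exact: measurable_opp_seq (measurable_smax_le k 0).
rewrite -[RHS]/(Q A) -(iid_reindex muQ (@rev_below_inj k) mA).
congr (Q _); apply/seteqP; split => y /=.
  move=> H; apply/smax_leP => j jk.
  by rewrite psum_opp psum_rev// oppr_le0 subr_ge0; apply: H; rewrite leq_subr.
move=> /smax_leP H j jk; have := H (k - j)%N (leq_subr _ _).
by rewrite psum_opp psum_rev ?leq_subr// oppr_le0 subr_ge0 subKn.
Qed.

Lemma walk_top_neg_indep k m :
  Q (walk_top k `&` reindex (addn k) @^-1` walk_neg m) =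
  (Q (walk_top k) * Q (walk_neg m))%E.
Proof.
pose g i : R -> R := if (i < k)%N then id else cst 0.
pose h i : R -> R := if (i < k)%N then cst 0 else id.
have gE y j : (j <= k)%N -> psum (map_coord g y) j = psum y j.
  move=> jk; apply: eq_bigr => i _.
  by rewrite /map_coord /g (leq_trans (ltn_ord i) jk).
have hE y : reindex (addn k) (map_coord h y) = reindex (addn k) y.
  by apply/funext => i; rewrite /reindex /map_coord /h ltnNge leq_addr.
have mF : measurable (reindex (addn k) @^-1` walk_neg m).
  rewrite -[X in measurable X]setTI.
  exact: measurable_reindex (measurable_walk_neg m).
have := @iid_indep _ _ _ muQ g h (walk_top k) (reindex (addn k) @^-1` walk_neg m).
rewrite (_ : map_coord g @^-1` _ = walk_top k); last first.
  apply/seteqP; split=> y /= H j jk; first by have := H j jk; rewrite !gE.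
  by rewrite !gE//; exact: H.
rewrite (_ : map_coord h @^-1` _ = reindex (addn k) @^-1` walk_neg m); last first.
  by apply/seteqP; split=> y /=; rewrite hE.
move=> ->//.
- by rewrite (iid_reindex muQ (@addnI k) (measurable_walk_neg m)).
- by move=> i; rewrite /g; case: ifP => _; [exact: measurable_id|exact: measurable_cst].
- by move=> i; rewrite /h; case: ifP => _; [exact: measurable_cst|exact: measurable_id].
- by move=> i; rewrite /g /h; case: ifP => _; [right|left]; exists 0.
- exact: measurable_walk_top.
Qed.

(* Decompose according to the last time at which the walk attains its maximum
   over [0, n]. *)
Lemma walk_duality n :
  1 <= \sum_(0 <= j < n.+1)
    stay (opp_seq_law Q) (n - j) 0 * fine (Q (walk_neg j)).
Proof.
pose F j := walk_top (n - j) `&` reindex (addn (n - j)) @^-1` walk_neg j.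
have mF j : measurable (F j).
  apply: measurableI; first exact: measurable_walk_top.
  rewrite -[X in measurable X]setTI.
  exact: measurable_reindex (measurable_walk_neg j).
have cover : [set: Rseq R] `<=` \big[setU/set0]_(j < n.+1) F j.
  move=> y _; have [k [kn H1 H2]] := last_argmax (psum y) n.
  rewrite -(bigcup_mkord n.+1 F); exists (n - k)%N => /=.
    by rewrite ltnS leq_subr.
  rewrite /F subKn//; split => // j /andP[j0 jn].
  have := H2 (k + j)%N; rewrite psum_shift gtrDl; apply.
  by rewrite -[X in (X < _)%N]addn0 ltn_add2l j0 -(subnKC kn) leq_add2l.
have : (1 <= \sum_(j < n.+1) Q (F j))%E.
  rewrite -(probability_setT Q).
  exact: (content_subadditive Q (fun j _ => mF j) measurableT cover).
rewrite big_mkord -lee_fin => /le_trans; apply.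
rewrite -sumEFin; apply: lee_sum => j _.
have mj := measurable_walk_neg j.
rewrite walk_top_neg_indep walk_topE EFinM.
have fj : Q (walk_neg j) \is a fin_num by exact: fin_num_measure.
by rewrite (fineK fj) lexx.
Qed.

Lemma walk_neg_antitone k l : (k <= l)%N ->
  fine (Q (walk_neg l)) <= fine (Q (walk_neg k)).
Proof.
move=> kl; have mk := measurable_walk_neg k; have ml := measurable_walk_neg l.
rewrite fine_le ?fin_num_measure//; apply: le_measure; rewrite ?inE//.
move=> y H j /andP[j0 jk]; apply: H; rewrite j0/=; exact: leq_trans kl.
Qed.

Lemma walk_neg_le_stay k : fine (Q (walk_neg k)) <= stay Q k 0.
Proof.
have mk := measurable_walk_neg k.
rewrite -lee_fin stayE fineK ?fin_num_measure//.
apply: le_measure; rewrite ?inE//; first exact: measurable_smax_le.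
move=> y H; apply/smax_leP => -[_|j jk]; first by rewrite /psum big_ord0.
by apply/ltW/H; rewrite jk.
Qed.

Lemma stay0_lower_bound (v : R) : centered_law mu v -> 0 < v ->
  exists2 c, 0 < c & forall m, (0 < m)%N -> c / Num.sqrt m%:R <= stay Q m 0.
Proof.
move=> muv v0.
have [C C0 HC] := stay0_bound muQ muv v0.
have [D D0 HD] := stay0_bound (iid_opp muQ) (centered_opp muv) v0.
have [||||c c0 Hc] := @convolution_lower_bound R
    (fun k => stay (opp_seq_law Q) k 0) (fun k => fine (Q (walk_neg k)))
    (C + D + 1) _ _ _ _ walk_duality.
- by rewrite ltr_wpDl ?addr_ge0.
- move=> k; rewrite stay_ge0/=; apply: le_trans (HD k) _.
  by rewrite ler_wpM2r ?invr_ge0 ?sqrtr_ge0//; lra.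
- move=> k; rewrite fine_ge0//=.
  apply: le_trans (walk_neg_le_stay k) _; apply: le_trans (HC k) _.
  by rewrite ler_wpM2r ?invr_ge0 ?sqrtr_ge0//; lra.
- exact: walk_neg_antitone.
by exists c => // m m0; apply: le_trans (Hc m m0) (walk_neg_le_stay m).
Qed.

End walk_negative.

Section ar2_walk.
Context {R : realType} {T : Type} (a1 a2 : R) (Y : nat -> T -> R).
Hypothesis a12 : a1 + a2 = 1.

Lemma ar2_pair_psum n t :
  (ar2_pair a1 a2 Y n t).1 + a2 * (ar2_pair a1 a2 Y n t).2 = psum (Y ^~ t) n.
Proof.
elim: n => [|n]; first by rewrite /= mulr0 addr0 /psum big_ord0.
rewrite psum_recr /=; case: (ar2_pair a1 a2 Y n t) => x xp /= <-.
have -> : a1 = 1 - a2 by rewrite -a12 addrK.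
ring.
Qed.

Lemma ar2_psum n t :
  psum (Y ^~ t) n.+1 = ar2 a1 a2 Y n.+1 t + a2 * ar2 a1 a2 Y n t.
Proof.
rewrite -ar2_pair_psum /ar2 /=.
by case: (ar2_pair a1 a2 Y n t).
Qed.

End ar2_walk.

Lemma measurable_ar2_pair d (T : measurableType d) (R : realType) (a1 a2 : R)
    (Y : nat -> T -> R) n : (forall i, measurable_fun setT (Y i)) ->
  measurable_fun setT (fun t => (ar2_pair a1 a2 Y n t).1) /\
  measurable_fun setT (fun t => (ar2_pair a1 a2 Y n t).2).
Proof.
move=> mY; elim: n => [|n [m1 m2]] /=.
  by split; exact: measurable_cst.
have E t : (let: (x, xp) := ar2_pair a1 a2 Y n t in
    (a1 * x + a2 * xp + Y n t, x)) =
    (a1 * (ar2_pair a1 a2 Y n t).1 + a2 * (ar2_pair a1 a2 Y n t).2 + Y n t,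
     (ar2_pair a1 a2 Y n t).1).
  by case: (ar2_pair a1 a2 Y n t).
split; under eq_fun do rewrite E /=; last exact: m1.
apply: measurable_funD => //; apply: measurable_funD;
  by apply: measurable_funM => //; exact: measurable_cst.
Qed.

Section iid_process.
Context {d : measure_display} {T : measurableType d} {R : realType}
  (P : probability T R) (Y : nat -> {RV P >-> R}).

Lemma measurable_process :
  measurable_fun setT ((fun t i => Y i t) : T -> Rseq R).
Proof. by apply: measurable_RseqP => i; exact: measurable_funPT. Qed.

Definition process_law : probability (Rseq R) R :=
  distribution P (mfun_of measurable_process).

Lemma iid_process_law :
  mutually_independent P (fun k => Y k) ->
  identically_distributed P (fun k => Y k) ->
  iid_law (distribution P (Y 0%N)) process_law.
Proof.
move=> indY idY s B us mB.
have := indY s B us mB; rewrite (_ : \bigcap_(i in _) _ =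
    [set t | forall i, i \in s -> B i (Y i t)]); last first.
  by apply/seteqP; split=> t /= H i si; exact: H.
move=> /= E; rewrite [LHS]E.
by apply: eq_bigr => i _; rewrite idY.
Qed.

Lemma centered_process_law :
  ('E_P[Y 0%N] = 0)%E ->
  ('E_P[fun t => (Y 0%N t ^+ 2)%R] < +oo)%E ->
  centered_law (distribution P (Y 0%N)) (fine 'E_P[fun t => (Y 0%N t ^+ 2)%R]).
Proof.
rewrite unlock => m1 m2.
have mY : measurable_fun setT (Y 0%N) by exact: measurable_funPT.
have m20 : (0 <= \int[P]_t (Y 0%N t ^+ 2)%:E)%E.
  by apply: integral_ge0 => t _; rewrite lee_fin sqr_ge0.
split.
  rewrite integral_distribution//; exact: integrable_of_sqr.
rewrite ge0_integral_distribution; last 2 first.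
- by apply/measurable_EFinP; exact: exprn_measurable.
- by move=> x; rewrite lee_fin sqr_ge0.
by rewrite fineK// ge0_fin_numE.
Qed.

Variables a1 a2 : R.
Hypothesis a12 : a1 + a2 = 1.

Lemma measurable_ar2_le x N : measurable
  [set t | forall n : nat, (1 <= n <= N)%N -> ar2 a1 a2 (fun k => Y k) n t <= x].
Proof.
rewrite (_ : mkset _ = \bigcap_n [set t | (1 <= n <= N)%N ->
    ar2 a1 a2 (fun k => Y k) n t <= x]); last first.
  by apply/seteqP; split=> y /= H j; [move=> _|]; exact: H.
apply: bigcapT_measurable => n; have [nN|nN] := boolP (1 <= n <= N)%N.
  rewrite (_ : mkset _ = [set t | ar2 a1 a2 (fun k => Y k) n t <= x]); last first.
    by apply/seteqP; split=> y /= H; [exact: H|move=> _].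
  rewrite -[X in measurable X]setTI; apply: measurable_fun_le => //.
  by apply: (measurable_ar2_pair a1 a2 n _).1 => i; exact: measurable_funPT.
by rewrite (_ : mkset _ = setT)//; apply/seteqP; split.
Qed.

Lemma measurable_process_smax_le x N :
  measurable [set t | smax N (fun i => Y i t) <= x].
Proof.
rewrite -[X in measurable X]setTI.
exact: (measurable_process measurableT (measurable_smax_le N x)).
Qed.

Lemma pN_le_stay x N : 0 < a2 -> 0 <= x ->
  pN P a1 a2 (fun k => Y k) x N <= stay process_law N ((1 + a2) * x).
Proof.
move=> a20 x0; have mE := measurable_ar2_le x N.
rewrite -lee_fin stayE /pN fineK ?fin_num_measure//.
apply: le_measure; rewrite ?inE//; first exact: measurable_process_smax_le.
move=> t /= H; apply/smax_leP => -[_|k kN].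
  by rewrite /psum big_ord0 mulr_ge0// addr_ge0// ltW.
rewrite (ar2_psum (fun k => Y k : T -> R) a12) mulrDl mul1r lerD//.
  by apply: H; rewrite kN.
by rewrite ler_pM2l//; case: k kN => [_|k kN]; [exact: x0|apply: H; rewrite (ltnW kN)].
Qed.

Lemma stay_le_pN x N : `|a2| < 1 -> a2 < 0 -> 0 <= x ->
  stay process_law N 0 <= pN P a1 a2 (fun k => Y k) x N.
Proof.
move=> a21 a20 x0; have mE := measurable_ar2_le x N.
rewrite -lee_fin stayE /pN fineK ?fin_num_measure//.
rewrite -[leLHS]/(P [set t | smax N (fun i => Y i t) <= 0]).
apply: le_measure; rewrite ?inE//; first exact: measurable_process_smax_le.
move=> t /= /smax_leP H n /andP[_]; elim: n => [//|n ih nN].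
have := H n.+1 nN; rewrite (ar2_psum (fun k => Y k : T -> R) a12).
have := ih (ltnW nN); set u := ar2 _ _ _ n t; set w := ar2 _ _ _ n.+1 t.
move: a21; rewrite ltr_norml => /andP[a2N _] ux uw; nra.
Qed.

End iid_process.

Theorem mainTheorem18 (d : measure_display) (T : measurableType d)
  (R : realType) (P : probability T R) (Y : nat -> {RV P >-> R}) (a1 a2 : R) :
  mutually_independent P (fun k => Y k) ->
  identically_distributed P (fun k => Y k) ->
  nondegenerate_rv P (Y 0%N) ->
  (expectation P (Y 0%N) = 0)%E ->
  (0 < expectation P (fun t => (Y 0%N t ^+ 2)%R))%E ->
  (expectation P (fun t => (Y 0%N t ^+ 2)%R) < +oo)%E ->
  a1 + a2 = 1 -> `|a2| < 1 ->
  (0 < a2 -> forall x : R, 0 <= x ->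
     exists C : R, exists N0 : nat, forall N : nat, (N0 <= N)%N ->
       pN P a1 a2 (fun k => Y k) x N <= C * (Num.sqrt (N%:R))^-1)
  /\
  (a2 < 0 -> forall x : R, 0 <= x ->
     exists C : R, exists N0 : nat, forall N : nat, (N0 <= N)%N ->
       (Num.sqrt (N%:R))^-1 <= C * pN P a1 a2 (fun k => Y k) x N).
Proof.
move=> indY idY _ mean0 var0 varoo a12 a21.
have muQ := iid_process_law indY idY.
have muv := centered_process_law mean0 varoo.
have v0 : 0 < fine 'E_P[fun t => Y 0%N t ^+ 2] by rewrite fine_gt0// var0.
split=> a20 x x0.
  have [|C C0 HC] := @stay_bound _ _ _ _ muQ muv v0 ((1 + a2) * x).
    by rewrite mulr_ge0// addr_ge0// ltW.
  exists C, 1%N => N N0; apply: le_trans (pN_le_stay Y a12 N a20 x0) _.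
  apply: le_trans (HC N) _; rewrite ler_wpM2l// lef_pV2 ?posrE ?sqrtr_gt0 ?ltr0n//.
  by rewrite ler_sqrt ?ler0n// ler_nat.
have [c c0 Hc] := stay0_lower_bound muQ muv v0.
exists c^-1, 1%N => N N0.
rewrite -(ler_pM2l c0) mulrA divff ?gt_eqF// mul1r.
exact: le_trans (Hc N N0) (stay_le_pN Y a12 N a21 a20 x0).
Qed.
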